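(* There is $q_0$ such that the following holds for every prime power $q\ge q_0$. Let $n=q^2$, and let $k,s$ be positive integers with $(ks)^{3/2}<\frac{n^{1/4}}{32\ln n}$. Then there exists a binary (i.e. over $\mathbb{F}_2$) $\bigl(n,N,k,2\lceil \sqrt n/s\rceil\bigr)$-BAC with $$N\le n+64(ks)^{3/2}n^{3/4}\ln n.$$
   Context: $[n]=\{1,\dots,n\}$. An $(n,N,k,m)$-batch array code (BAC) over $\mathbb{F}_2$ is an $\mathbb{F}_2$-linear map $\mathcal{C}:\mathbf x=(x_1,\dots,x_n)\in\mathbb{F}_2^n\mapsto(\mathbf c_1,\dots,\mathbf c_m)$ with buckets $\mathbf c_\ell\in\mathbb{F}_2^{N_\ell}$, $N_\ell\ge1$ independent of $\mathbf x$, $\sum_\ell N_\ell=N$, such that for every multiset $\{\{i_1,\dots,i_k\}\}$ of elements of $[n]$ there is a partition of $[m]$ into $k$ sets $R_1,\dots,R_k$ such that for each $j\in[k]$, $x_{i_j}$ is an $\mathbb{F}_2$-linear combination of values $f_\ell(\mathbf c_\ell)$, $\ell\in R_j$, for some linear functionals $f_\ell:\mathbb{F}_2^{N_\ell}\to\mathbb{F}_2$ (independent of $\mathbf x$). *)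

(* Defs.v *)
From HB Require Import structures.
From mathcomp Require Import all_boot all_order all_algebra.
From mathcomp Require Import all_classical all_reals all_analysis.
From mathcomp Require Import Rstruct.
Set Implicit Arguments. Unset Strict Implicit. Unset Printing Implicit Defensive.
Import Order.TTheory GRing.Theory Num.Theory.
Local Open Scope ring_scope.

(* An (n,N,k,m)-batch array code over F_2.
   - bucket l (l : 'I_m) has size Ns l >= 1, sizes sum to N;
   - the encoder of bucket l is the linear map x |-> x *m G l,
     x : 'rV_n, G l : 'M_(n, Ns l);
   - for every request multiset {{i_1,...,i_k}} (given as req : 'I_k -> 'I_n)
     there is a partition of the buckets into k parts (part l = index of the
     part containing bucket l) and linear functionals f l : 'cV_(Ns l) such that
     x_{req j} is the F_2-linear combination (all coefficients can be absorbed
     into the functionals f l) of f_l(c_l), l in part j, for every x. *)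
Definition BAC (n N k m : nat) : Prop :=
  exists (Ns : 'I_m -> nat) (G : forall l : 'I_m, 'M['F_2]_(n, Ns l)),
    [/\ (forall l, (0 < Ns l)%N),
        (\sum_(l < m) Ns l)%N = N &
        forall req : 'I_k -> 'I_n,
          exists (part : 'I_m -> 'I_k) (f : forall l : 'I_m, 'cV['F_2]_(Ns l)),
            forall (j : 'I_k) (x : 'rV['F_2]_n),
              x 0 (req j) = \sum_(l < m | part l == j) (x *m G l *m f l) 0 0].

Definition prime_power (q : nat) : Prop :=
  exists p e : nat, [/\ prime p, (0 < e)%N & q = (p ^ e)%N].

(* Main.v *)
Require Import Defs.
From HB Require Import structures.
From mathcomp Require Import all_boot all_order all_algebra all_field.
From mathcomp Require Import all_classical all_reals all_analysis.
From mathcomp Require Import Rstruct ring lra zify.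
Import Order.TTheory GRing.Theory Num.Theory.
Local Open Scope ring_scope.

(** Put the n = q^2 symbols in B = ceil(q/s) data buckets of about q s rows, and
    place the data buckets injectively in the plane F^2, where F is a field of
    characteristic 2 whose size r is of order sqrt(k B). For a slope l in a small
    set S, a line of slope l and a row y, one parity bucket stores the sum of the
    symbols in row y of the data buckets on that line; each pair (slope, line) has
    its own parity bucket. A symbol of bucket c is recovered along any line
    through c with slope in S, reading only that line minus c and its parity
    bucket.

    Serve the requests greedily. A line carries at most B/r + 1 buckets, and each
    bucket other than c rules out one slope at c, so the lines already chosen rule
    out at most half of F. There are at most B (B r)^k configurations (bucket to
    serve, lines already chosen); adding to S, one at a time, a slope that settles
    at least half of the remaining configurations, about log_2 of that number,
    i.e. O(k ln q), slopes are enough. *)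

(** * Averaging and covering *)

(** Double counting: each [x] is bad for at most half of [Y], so the number of bad elements of [U],
    averaged over [y], is at most [#|U| / 2]. *)
Lemma exists_halving (X Y : finType) (bad : X -> Y -> bool) (y0 : Y) (U : {set X}) :
  (forall x, 2 * #|[set y | bad x y]| <= #|Y|)%N ->
  exists y, (2 * #|[set x in U | bad x y]| <= #|U|)%N.
Proof.
move=> few; apply/existsP; apply: contraT; rewrite negb_exists => /forallP nex.
have dc : (\sum_(y : Y) #|[set x in U | bad x y]| = \sum_(x in U) #|[set y | bad x y]|)%N.
  under eq_bigr do rewrite -sum1_card; under [RHS]eq_bigr do rewrite -sum1_card.
  rewrite (exchange_big_dep [pred x | x \in U]) /=; last by move=> y x _; rewrite inE => /andP[].
  by apply: eq_bigr => x xU; apply: eq_bigl => y; rewrite !inE xU.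
have : (#|Y| * #|U|.+1 <= #|Y| * #|U|)%N.
  apply: (@leq_trans (2 * \sum_(y : Y) #|[set x in U | bad x y]|)%N).
    rewrite big_distrr /= -sum_nat_const; apply: leq_sum => y _.
    by rewrite ltnNge; exact: nex.
  rewrite dc big_distrr /= mulnC -sum_nat_const; exact: leq_sum.
rewrite leq_pmul2l ?ltnn //; by apply/card_gt0P; exists y0.
Qed.

(** Each new choice halves the set of [x] that are bad for all choices so far; after [d] choices
    fewer than one is left. *)
Lemma exists_cover (X Y : finType) (bad : X -> Y -> bool) (y0 : Y) (d : nat) :
  (forall x, 2 * #|[set y | bad x y]| <= #|Y|)%N -> (#|X| < 2 ^ d)%N ->
  exists y : 'I_d -> Y, forall x, exists i, ~~ bad x (y i).
Proof.
move=> few ltXd.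
have [y hy] : exists y : nat -> Y,
    (2 ^ d * #|[set x | [forall i : 'I_d, bad x (y i)]]| <= #|X|)%N.
  elim: d {ltXd} => [|d [y hy]].
    by exists (fun=> y0); rewrite mul1n max_card.
  have [z hz] := exists_halving _ _ bad y0 [set x | [forall i : 'I_d, bad x (y i)]] few.
  (* The choices form a sequence on [nat], so it is extended at index [d] without casts between
     ordinals. *)
  exists (fun i => if (i < d)%N then y i else z).
  apply: leq_trans hy; rewrite expnSr -mulnA leq_pmul2l ?expn_gt0 //.
  apply: leq_trans hz; rewrite leq_pmul2l //; apply/subset_leq_card/fintype.subsetP => x.
  rewrite !inE => /forallP h; apply/andP; split; last by have := h ord_max; rewrite ltnn.
  by apply/forallP => i; have := h (widen_ord (leqnSn d) i); rewrite /= ltn_ord.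
exists (fun i => y i) => x; apply/existsP; rewrite -[[exists _, _]]negbK negb_exists.
apply/negP => /forallP h.
have : (0 < #|[set x | [forall i : 'I_d, bad x (y i)]]|)%N.
  by apply/card_gt0P; exists x; rewrite inE; apply/forallP => i; have := h i; rewrite negbK.
move=> c0; move: ltXd; rewrite ltnNge; apply/negP/negPn; apply: leq_trans hy.
by rewrite -[X in (X <= _)%N]muln1 leq_pmul2l ?expn_gt0.
Qed.

(** * From lines of buckets to a batch array code *)

(** [P] indexes the parity buckets and [E p] is the set of data buckets summed in [p]. Request [j]
    reads the parity bucket of [h j] and the data buckets of [E (h j)] other than [c j]; injectivity
    and disjointness keep the requests apart. *)
Lemma design_BAC (n k B R : nat) (P : finType) (loc : 'I_n -> 'I_B * 'I_R)
    (E : P -> {set 'I_B}) :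
  injective loc -> (0 < R)%N -> (0 < k)%N -> (#|P| <= B)%N ->
  (forall c : 'I_k -> 'I_B, exists h : 'I_k -> P,
     [/\ injective h, forall j, c j \in E (h j) &
         forall i j, i != j -> [disjoint E (h i) :\ c i & E (h j) :\ c j]]) ->
  exists2 N : nat, BAC n N k (B + B) & (N <= B * R + #|P| * R + B)%N.
Proof.
move=> loc_inj R0 k0 PB des.
pose enc (p : P) : 'I_B := widen_ord PB (enum_rank p).
have enc_inj : injective enc.
  by move=> p p' /(congr1 val) /= /val_inj /enum_rank_inj.
pose dec (l : 'I_B) : option P := [pick p | enc p == l].
have encK p : dec (enc p) = Some p.
  by rewrite /dec; case: pickP => [p' /eqP/enc_inj -> //|/(_ p)]; rewrite eqxx.
have decK l p : dec l = Some p -> enc p = l.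
  by rewrite /dec; case: pickP => // p' /eqP <- [->].
(* A parity bucket with no line attached holds one constant zero, since sizes must be positive. *)
pose Ns (l : 'I_(B + B)) := match fintype.split l with
  | inl _ => R | inr l' => if dec l' is Some _ then R else 1%N end.
(* the coefficient of x_i in the symbol y of the bucket l *)
pose coef (i : 'I_n) (l : 'I_(B + B)) (y : nat) : bool := ((loc i).2 == y :> nat) &&
  match fintype.split l with
  | inl c => (loc i).1 == c
  | inr l' => if dec l' is Some p then (loc i).1 \in E p else false end.
exists (\sum_l Ns l)%N.
- exists Ns, (fun l => \matrix_(i, y) (coef i l y)%:R); split => //.
    by move=> l; rewrite /Ns; case: (fintype.split l) => // l'; case: (dec l').
  move=> req; pose c j := (loc (req j)).1; pose row j := (loc (req j)).2.
  have [h [h_inj cE disj]] := des c.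
  pose reads j (l : 'I_(B + B)) := match fintype.split l with
    | inl b => b \in E (h j) :\ c j
    | inr l' => dec l' == Some (h j) end.
  have rd_inj i j l : reads i l -> reads j l -> i = j.
    rewrite /reads; case: (fintype.split l) => [b bi bj|l' /eqP -> /eqP[/h_inj] //].
    apply/eqP; apply: contraT => /disj /pred0P /(_ b) /=; by rewrite bi bj.
  (* Buckets that no request reads go to part 0, with the zero functional. *)
  pose part l := odflt (Ordinal k0) [pick j | reads j l].
  have partE j l : reads j l -> part l = j.
    move=> rj; rewrite /part; case: pickP => [i ri|/(_ j)]; last by rewrite rj.
    exact: rd_inj ri rj.
  exists part, (fun l => \col_(y < Ns l) (reads (part l) l && (y == row (part l) :> nat))%:R).
  move=> j x.
  have term l : part l == j -> (x *m (\matrix_(i, y) (coef i l y)%:R) *m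
      (\col_(y < Ns l) (reads (part l) l && (y == row (part l) :> nat))%:R)) 0 0
      = (reads j l)%:R * \sum_i x 0 i * (coef i l (row j))%:R.
    move=> /eqP ->; case rl: (reads j l); last first.
      rewrite mul0r mxE big1 // => y _; by rewrite !mxE /= mulr0.
    have rowlt : (row j < Ns l)%N.
      move: rl; rewrite /reads /Ns; case: (fintype.split l) => // l' /eqP ->; exact: ltn_ord.
    rewrite mul1r mxE (bigD1 (Ordinal rowlt)) //= big1 ?addr0.
      rewrite !mxE eqxx mulr1; apply: eq_bigr => i _; by rewrite mxE.
    move=> y ny; rewrite !mxE (_ : (y == row j :> nat) = false) ?mulr0 //.
    by apply/negbTE; apply: contra ny => /eqP e; apply/eqP/val_inj.
  rewrite (eq_bigr _ term).
  have -> : \sum_(l | part l == j) (reads j l)%:R * \sum_i x 0 i * (coef i l (row j))%:R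
     = \sum_l (reads j l)%:R * \sum_i x 0 i * (coef i l (row j))%:R.
    rewrite [RHS](bigID (fun l => part l == j)) /= [X in _ = _ + X]big1 ?addr0 // => l nl.
    case rl: (reads j l); last by rewrite mul0r.
    by rewrite (partE _ _ rl) eqxx in nl.
  have -> : \sum_l (reads j l)%:R * (\sum_i x 0 i * (coef i l (row j))%:R)
     = \sum_i x 0 i * \sum_l (reads j l && coef i l (row j))%:R.
    under eq_bigr do rewrite big_distrr /=; rewrite exchange_big /=.
    apply: eq_bigr => i _; rewrite big_distrr /=; apply: eq_bigr => l _.
    by rewrite mulrCA -natrM mulnb.
  (* In the requested row, a symbol from another bucket of [E (h j)] is read twice, directly and
     inside the parity, and cancels in ['F_2]; the symbol of [c j] enters through the parity
     alone. *)
  have delta i : \sum_l (reads j l && coef i l (row j))%:R = (i == req j)%:R :> 'F_2.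
    have -> : (i == req j) = ((loc i).1 == c j) && ((loc i).2 == row j).
      by rewrite -(inj_eq loc_inj) -pair_eqE.
    rewrite big_split_ord /=.
    under eq_bigr => b _ do rewrite /reads /coef (unsplitK (inl b)).
    under [X in _ + X]eq_bigr => b _ do rewrite /reads /coef (unsplitK (inr b)).
    case: ((loc i).2 =P row j) => [->|ne]; last first.
      rewrite (introF eqP (fun e => ne (val_inj e))) andbF !big1 ?addr0 // => b _.
        by rewrite andbF.
      by rewrite andbF.
    rewrite eqxx andbT (bigD1 (loc i).1) //= big1 => [|b nb]; last first.
      by rewrite eq_sym (negbTE nb) andbF.
    rewrite (bigD1 (enc (h j))) //= big1 => [|b nb]; last first.
      case: eqP => // /decK e; by rewrite e eqxx in nb.
    rewrite encK !eqxx !andbT !addr0 /= finset.in_setD1.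
    case: eqP => [->|_] /=; first by rewrite cE add0r.
    by case: (_ \in _); rewrite ?addr0 //; apply/eqP.
  under eq_bigr do rewrite delta.
  rewrite (bigD1 (req j)) //= eqxx mulr1 big1 ?addr0 // => i /negbTE ->.
  by rewrite mulr0.
- rewrite big_split_ord /=.
  under eq_bigr => b _ do rewrite /Ns (unsplitK (inl b)).
  under [X in (_ + X <= _)%N]eq_bigr => b _ do rewrite /Ns (unsplitK (inr b)).
  rewrite sum_nat_const card_ord -addnA leq_add2l.
  apply: (@leq_trans (\sum_(b < B) ((dec b : bool) * R + 1))%N).
    by apply: leq_sum => b _; case: (dec b) => [p|] //=; rewrite mul1n addn1.
  rewrite big_split /= sum1_card card_ord leq_add2r -big_distrl /= leq_mul2r.
  rewrite -(fintype.card_image enc_inj) -sum1_card [leqRHS]big_mkcond /=; apply/orP; right.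
  apply: leq_sum => b _; case e: (dec b) => [p|] //=.
  by rewrite -(decK _ _ e) fintype.image_f.
Qed.

(** * Lines in the affine plane *)

Lemma leq_card_bigcup (I T : finType) (A : I -> {set T}) :
  (#|\bigcup_i A i| <= \sum_i #|A i|)%N.
Proof.
elim/big_rec2: _ => [|i n S _ le]; first by rewrite cards0.
by apply: leq_trans (leq_card_setU _ _) _; rewrite leq_add2l.
Qed.

(** In the bound on [#|F|], each of [k] lines forbids its own slope and at most [B %/ #|F| + 1]
    slopes towards its buckets. The bound on [2 ^ d] counts the configurations. *)
Lemma slope_design (F : finFieldType) (B k d : nat) :
  (0 < k)%N -> (2 * (k * (B %/ #|F| + 2)) <= #|F|)%N ->
  (B * (B * #|F|) ^ k < 2 ^ d)%N ->
  exists E : 'I_d * F -> {set 'I_B}, forall c : 'I_k -> 'I_B,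
    exists h : 'I_k -> 'I_d * F,
     [/\ injective h, forall j, c j \in E (h j) &
         forall i j, i != j -> [disjoint E (h i) :\ c i & E (h j) :\ c j]].
Proof.
move=> k0 kF cardX; pose r := #|F|.
have r0 : (0 < r)%N by apply/card_gt0P; exists 0.
(* Keeps the quotients [c %/ r] below [r], so that [nth] never returns its default in [al]. *)
have tr : ((B %/ r).+1 < r)%N.
  by apply: leq_trans kF; rewrite mulnA addn2 leq_pmull // muln_gt0.
(* the bucket c is the point (al c, be c) of the plane F^2 *)
pose al (c : 'I_B) := nth 0 (enum F) (c %/ r).
pose be (c : 'I_B) := nth 0 (enum F) (c %% r).
have alr (c : 'I_B) : (c %/ r < (B %/ r).+1)%N by rewrite ltnS leq_div2r // ltnW.
have al_inj c c' : al c = al c' -> (c %/ r = c' %/ r)%N.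
  move/eqP; rewrite nth_uniq -?cardE ?enum_uniq //; first by move/eqP.
    exact: ltn_trans (alr _) tr.
  exact: ltn_trans (alr _) tr.
have albe_inj c c' : al c = al c' -> be c = be c' -> c = c'.
  move=> /al_inj e /eqP; rewrite nth_uniq -?cardE ?enum_uniq ?ltn_mod // => /eqP e'.
  by apply: val_inj; rewrite /= (divn_eq c r) e e' -divn_eq.
pose cst (l : F) (c : 'I_B) := be c - l * al c.
pose line (l : F) (c : 'I_B) := [set c' | cst l c' == cst l c].
(* No line is vertical, so the first coordinate, with at most [(B %/ r).+1] values, determines a
   bucket on it. *)
have line_inj l c : {in line l c &, forall a b, al a = al b -> a = b}.
  move=> a b; rewrite !inE => /eqP ea /eqP eb e; apply: albe_inj => //.
  by move: ea; rewrite -eb /cst e => /addIr.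
have card_line l c : (#|line l c| <= (B %/ r).+1)%N.
  rewrite -[leqRHS]card_ord.
  apply: (@leq_card_in _ _ (fun b : 'I_B => Ordinal (alr b))) => a b al_ bl [e].
  by apply: line_inj al_ bl _; rewrite /al e.
(* Equal slopes are forbidden so that no two requests share a parity bucket. *)
pose bad (x : 'I_B * {ffun 'I_k -> 'I_B * F}) (l : F) := [exists i,
  (l == (x.2 i).2) || ~~ [disjoint line l x.1 :\ x.1 & line (x.2 i).2 (x.2 i).1]].
have few x : (2 * #|[set l | bad x l]| <= #|F|)%N.
  apply: leq_trans kF; rewrite leq_mul2l /=; case: x => c h.
  (* a bucket b <> c lies on the line of slope l through c only for l = slope b *)
  pose slope b := (be b - be c) / (al b - al c).
  have : [set l | bad (c, h) l] \subset
     \bigcup_i ((h i).2 |: slope @: line (h i).2 (h i).1).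
    apply/fintype.subsetP => l; rewrite inE => /existsP[i /= /orP[/eqP ->|]].
      by apply/finset.bigcupP; exists i => //; rewrite finset.setU11.
    rewrite -finset.setI_eq0 => /finset.set0Pn[b]; rewrite !inE => /andP[/andP[nbc bl] bi].
    apply/finset.bigcupP; exists i => //; rewrite !inE; apply/orP; right.
    apply/finset.imsetP; exists b; first by rewrite inE.
    have nal : al b - al c != 0.
      rewrite subr_eq0; apply: contra nbc => /eqP e; apply/eqP.
      by apply: (line_inj l c) e; rewrite inE.
    apply: (canRL (mulfK nal)); move/eqP: bl; rewrite /cst => e.
    have -> : be b = be c - l * al c + l * al b by rewrite -e subrK.
    ring.
  move/subset_leq_card/leq_trans; apply; apply: leq_trans (leq_card_bigcup _ _ _) _.
  rewrite -[k in leqRHS]card_ord -sum_nat_const; apply: leq_sum => i _.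
  rewrite addn2 -addn1 addnC cardsU1; apply: leq_add; first by case: (_ \notin _).
  exact: leq_trans (leq_imset_card _ _) (card_line _ _).
have ltX : (#|{: 'I_B * {ffun 'I_k -> 'I_B * F}}| < 2 ^ d)%N.
  by rewrite card_prod card_ffun card_prod !card_ord.
have [y hy] := exists_cover _ _ bad 0 d few ltX.
exists (fun p => [set c | cst (y p.1) c == p.2]) => c.
have greedy m : (m <= k)%N -> exists io : 'I_k -> 'I_d, forall i j : 'I_k,
    (i < j < m)%N -> y (io j) != y (io i) /\
    [disjoint line (y (io j)) (c j) :\ c j & line (y (io i)) (c i)].
  elim: m => [_|m IH mk].
    (* An arbitrary configuration, used to get an element of ['I_d]. *)
    have [z _] := hy (c (Ordinal k0), [ffun i => (c i, 0)]).
    by exists (fun=> z) => i j; rewrite ltn0 andbF.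
  have [io hio] := IH (ltnW mk); pose om := Ordinal mk.
  (* the entries of io from index m on are junk that pads the list of k lines *)
  have [z] := hy (c om, [ffun i => (c i, y (io i))]).
  rewrite /bad negb_exists => /forallP hz.
  exists (fun i => if i == om then z else io i) => i j /andP[ij].
  move=> jm; have -> : (i == om) = false.
    by apply/eqP => e; move: ij; rewrite e ltnNge /= -ltnS jm.
  case: (j =P om) => [->|nj].
    by have /= := hz i; rewrite !ffunE /= negb_or negbK => /andP[].
  apply: hio; rewrite ij ltn_neqAle -ltnS jm andbT.
  by apply/eqP => e; apply: nj; apply: val_inj.
have [io hio] := greedy k (leqnn k).
exists (fun j => (io j, cst (y (io j)) (c j))); split => /=.
- move=> i j [e _]; case: (ltngtP i j) => [ij|ji|/val_inj//].
    by have [|/eqP ne _] := hio i j; [rewrite ij /=|case: ne; rewrite e].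
  by have [|/eqP ne _] := hio j i; [rewrite ji /=|case: ne; rewrite e].
- by move=> j; rewrite inE.
- move=> i j; have sub (a b : 'I_k) : (a < b)%N ->
    [disjoint line (y (io b)) (c b) :\ c b & line (y (io a)) (c a) :\ c a].
    move=> ab; have [|_] := hio a b; first by rewrite ab /=.
    by apply: disjointWr; apply: finset.subsetDl.
  rewrite neq_ltn => /orP[/sub|/sub //]; by rewrite disjoint_sym.
Qed.

(** * Parameters and estimates *)

Lemma grid_injection (n B : nat) : (0 < B)%N ->
  {loc : 'I_n -> 'I_B * 'I_(n.-1 %/ B).+1 | injective loc}.
Proof.
move=> B0; pose r := (n.-1 %/ B).+1.
have lt1 (p : 'I_n) : (p %/ r < B)%N.
  rewrite ltn_divLR // mulnC; apply: leq_trans (ltn_ord p) _.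
  by rewrite (leq_trans (leqSpred n)) // ltn_ceil.
have lt2 (p : 'I_n) : (p %% r < r)%N by rewrite ltn_mod.
exists (fun p => (Ordinal (lt1 p), Ordinal (lt2 p))) => p p' [e e'].
by apply: val_inj; rewrite /= (divn_eq p r) e e' -divn_eq.
Qed.

(** The least exponent works. It gives a field of characteristic 2 whose size is within a factor 2
    of the square root of [x]. *)
Lemma exists_pow2_between (x : nat) : (1 < x)%N ->
  exists2 e, (0 < e)%N & (x <= (2 ^ e) ^ 2 < 4 * x)%N.
Proof.
move=> x1; have ex : exists e, (x <= (2 ^ e) ^ 2)%N.
  exists x; apply: leq_trans (leq_pexp2l _ (isT : 0 < 2)%N); last by rewrite expn_gt0.
  by rewrite expn1 ltnW // ltn_expl.
case: (ex_minnP ex) => -[|e] xe min; first by rewrite exp1n leqNgt x1 in xe.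
exists e.+1; rewrite ?xe //=.
have -> : ((2 ^ e.+1) ^ 2 = 4 * (2 ^ e) ^ 2)%N by rewrite (expnS 2 e) expnMn.
rewrite ltn_pmul2l // ltnNge.
by apply/negP => /min; rewrite ltnn.
Qed.

Lemma ln2_ge_half (R : realType) : 1 / 2 <= ln (2 : R).
Proof.
have := @le_ln1Dx R (- (1 / 2)); rewrite (_ : 1 + _ = 2^-1); last by field.
by rewrite lnV ?posrE //; lra.
Qed.

(** Here [T] is [(k * s)] to the power 3/2, [w] the fourth root of [n], [L] the logarithm of [q],
    and [D * r] the number of lines. Comparing squares avoids fractional powers. *)
Lemma parameter_bounds (R : realType) (k s q B r D T w L : R) :
  1 <= k -> 1 <= s -> 1 <= L -> 0 <= T -> T ^+ 2 = (k * s) ^+ 3 ->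
  0 <= w -> w ^+ 2 = q -> 64 * T * L < w ->
  0 <= B -> q <= s * B -> s * B <= q + s -> 0 <= r -> r ^+ 2 <= 16 * k * B ->
  0 <= D -> D <= 7 * k * L ->
  D * r <= B /\ 2 * B + D * r * (q * s) <= 128 * T * w ^+ 3 * L.
Proof.
move=> k1 s1 L1 T0 T2 w0 w2 Tw B0 qsB sBq r0 r2 D0 DL.
have k0 : 0 <= k := le_trans ler01 k1.
have sp : 0 < s := lt_le_trans ltr01 s1.
have s0 := ltW sp.
have L0 : 0 <= L := le_trans ler01 L1.
have K1 : 1 <= k * s by rewrite mulr_ege1.
have K0 : 0 <= k * s := le_trans ler01 K1.
have L2 : 1 <= L ^+ 2 by rewrite exprn_ege1.
have K3 : k * s <= (k * s) ^+ 3 by rewrite ler_eXnr.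
have sK : s <= k * s by rewrite ler_peMl //.
have kK : k ^+ 3 * s <= (k * s) ^+ 3.
  rewrite exprMn ler_wpM2l ?exprn_ge0 //; exact: ler_eXnr.
have T1 : 1 <= T by rewrite -(@ler_pXn2r _ 2) ?nnegrE // T2 expr1n exprn_ege1.
have qK : 4096 * ((k * s) ^+ 3 * L ^+ 2) <= q.
  rewrite -w2 -T2 (_ : _ * _ = (64 * T * L) ^+ 2); last by ring.
  by rewrite ler_pXn2r ?nnegrE // ?(ltW Tw) // !mulr_ge0 //.
have q0 : 0 <= q by rewrite -w2 exprn_ge0.
have KL : (k * s) ^+ 3 <= (k * s) ^+ 3 * L ^+ 2.
  by rewrite ler_peMr // exprn_ge0 //.
have sq : s <= q by lra.
have sB2q : s * B <= 2 * q by rewrite mulr_natl mulr2n (le_trans sBq) // lerD2l.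
have w1 : 1 <= w by rewrite -(@ler_pXn2r _ 2) ?nnegrE // expr1n w2; lra.
have Dr2 : (D * r) ^+ 2 <= 784 * (k ^+ 3 * L ^+ 2) * B.
  have -> : 784 * (k ^+ 3 * L ^+ 2) * B = (7 * k * L) ^+ 2 * (16 * k * B) by ring.
  rewrite exprMn ler_pM ?exprn_ge0 //.
  by rewrite ler_pXn2r ?nnegrE // (le_trans D0).
have kLs : k ^+ 3 * L ^+ 2 * s <= (k * s) ^+ 3 * L ^+ 2.
  by rewrite mulrAC ler_wpM2r ?exprn_ge0.
split.
  rewrite -(@ler_pXn2r _ 2) ?nnegrE // ?mulr_ge0 //; apply: le_trans Dr2 _.
  rewrite [leRHS]expr2 ler_wpM2r // -(ler_pM2r sp) (mulrC B).
  by move: kLs qK qsB; rewrite -mulrA; lra.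
have TwL : w ^+ 2 <= T * w ^+ 3 * L.
  rewrite (_ : T * _ * L = (T * w * L) * w ^+ 2); last by ring.
  by rewrite ler_peMl ?exprn_ge0 // !mulr_ege1.
(* The constant 40 suffices because [s * B <= 2 * q] and [784 * 2 <= 40 ^ 2]. *)
have P : D * r * (q * s) <= 40 * T * w ^+ 3 * L.
  have q_s : 0 <= q * s by rewrite mulr_ge0.
  have RHS0 : 0 <= 40 * T * w ^+ 3 * L.
    by rewrite !mulr_ge0 ?exprn_ge0 //.
  rewrite -(@ler_pXn2r _ 2) ?nnegrE // ?mulr_ge0 //.
  have -> : (40 * T * w ^+ 3 * L) ^+ 2 = 1600 * ((k * s) ^+ 3 * L ^+ 2) * q ^+ 3.
    by rewrite -T2 -w2; ring.
  have h : (D * r) ^+ 2 * (q * s) ^+ 2 <= (784 * (k ^+ 3 * L ^+ 2) * B) * (q * s) ^+ 2.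
    by rewrite ler_wpM2r // exprn_ge0.
  rewrite exprMn; apply: le_trans h _.
  have Y0 : 0 <= (k * s) ^+ 3 * L ^+ 2 * q ^+ 3.
    by rewrite !mulr_ge0 ?exprn_ge0 //.
  have h' : k ^+ 3 * L ^+ 2 * s * (s * B) <= (k * s) ^+ 3 * L ^+ 2 * (2 * q).
    apply: ler_pM sB2q => //; last by rewrite mulr_ge0.
    by rewrite !mulr_ge0 ?exprn_ge0 //.
  have {}h' : k ^+ 3 * L ^+ 2 * s * (s * B) * q ^+ 2 <= 2 * ((k * s) ^+ 3 * L ^+ 2 * q ^+ 3).
    rewrite (_ : 2 * _ = (k * s) ^+ 3 * L ^+ 2 * (2 * q) * q ^+ 2); last by ring.
    by rewrite ler_wpM2r ?exprn_ge0.
  rewrite (_ : 1600 * _ * _ = 1600 * ((k * s) ^+ 3 * L ^+ 2 * q ^+ 3)); last by ring.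
  rewrite (_ : 784 * _ * _ * _ = 784 * (k ^+ 3 * L ^+ 2 * s * (s * B) * q ^+ 2));
    last by ring.
  clear -h' Y0; set Y := _ * q ^+ 3 in h' Y0 *; set X := _ * q ^+ 2 in h' *.
  lra.
have BsB : B <= s * B by rewrite ler_peMl.
rewrite w2 in TwL; clear -P TwL BsB sB2q q0; set Z := T * w ^+ 3 * L in TwL.
rewrite (_ : 128 * T * _ * L = 128 * Z); last by rewrite /Z; ring.
move: P; rewrite (_ : 40 * T * _ * L = 40 * Z); last by rewrite /Z; ring.
lra.
Qed.

Theorem theorem4p11 :
  exists q0 : nat, forall q : nat, (q0 <= q)%N -> prime_power q ->
  forall k s : nat, (0 < k)%N -> (0 < s)%N ->
  let n := (q ^ 2)%N in
  powR ((k * s)%:R : Rdefinitions.R) (3 / 2)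
    < powR (n%:R : Rdefinitions.R) (1 / 4) / (32 * ln (n%:R : Rdefinitions.R)) ->
  exists N : nat,
    BAC n N k `|(2%:Z * Num.ceil (Num.sqrt (n%:R : Rdefinitions.R) / s%:R))%R|%N /\
    (N%:R : Rdefinitions.R) <=
      n%:R + 64 * powR ((k * s)%:R) (3 / 2) * powR (n%:R) (3 / 4) * ln (n%:R).
Proof.
(* The threshold 4 ensures [1 <= ln q]. *)
exists 4%N => q q4 _ k s k0 s0 n.
set R := Rdefinitions.R; set T := powR _ (3 / 2).
pose L : R := ln q%:R; pose w : R := Num.sqrt q%:R.
have qn0 : (0 < q)%N by apply: leq_trans q4.
have q0 : 0 < q%:R :> R by rewrite ltr0n.
have w0 : 0 <= w by rewrite sqrtr_ge0.
have w2 : w ^+ 2 = q%:R by rewrite sqr_sqrtr // ltW.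
have lnn : ln n%:R = 2 * L :> R by rewrite natrX lnXn // mulr_natl.
have nE : n%:R = w ^+ 4 :> R by rewrite natrX -w2 -exprM.
have w4 x : powR (n%:R : R) (x / 4) = powR w x.
  by rewrite nE -powR_mulrn // -powRrM mulrC divfK // pnatr_eq0.
have -> : powR (n%:R : R) (1 / 4) = w by rewrite w4 powRr1.
have -> : powR (n%:R : R) (3 / 4) = w ^+ 3 by rewrite w4 powR_mulrn.
have -> : Num.sqrt (n%:R : R) = q%:R by rewrite natrX sqrtr_sqr ger0_norm // ltW.
rewrite lnn.
have L1 : 1 <= L.
  have : ln (4 : R) <= L by rewrite ler_ln ?posrE // ler_nat.
  have -> : (4 : R) = 2 ^+ 2 by ring.
  by rewrite lnXn //; have := ln2_ge_half R; lra.
have T0 : 0 <= T by rewrite powR_ge0.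
have T2 : T ^+ 2 = (k%:R * s%:R) ^+ 3.
  rewrite /T -natrM -!powR_mulrn // -?powRrM ?powR_ge0 //; congr powR; lra.
move=> hyp; have {hyp}Tw : 64 * T * L < w.
  move: hyp; rewrite ltr_pdivlMr; last by lra.
  by rewrite (_ : T * _ = 64 * T * L); last by ring.
pose B := `|Num.ceil (q%:R / s%:R : R)|%N.
have sR : 0 < s%:R :> R by rewrite ltr0n.
have BE : Num.ceil (q%:R / s%:R : R) = B%:Z.
  by rewrite gez0_abs // ceil_ge0 (lt_le_trans _ (divr_ge0 (ltW q0) (ltW sR))) // ltrN10.
have qsB : (q <= s * B)%N.
  have := ceil_ge (q%:R / s%:R : R); rewrite BE ler_pdivrMr // -natrM ler_nat.
  by rewrite mulnC.
have sBq : (s * B < q + s)%N.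
  have := ceilB1_lt (q%:R / s%:R : R); rewrite BE ltr_pdivlMr // intrD.
  rewrite mulrDl mulN1r ltrBlDr -natrM -natrD ltr_nat; by rewrite mulnC.
have -> : `|(2%:Z * Num.ceil (q%:R / s%:R : R))%R|%N = (B + B)%N by rewrite BE; lia.
have ks64 : (64 * (k * s) < q)%N.
  have K1 : 1 <= (k * s)%:R :> R by rewrite ler1n muln_gt0 k0.
  have KT : (k * s)%:R <= T.
    rewrite -(@ler_pXn2r _ 2) ?nnegrE // ?(le_trans ler01) // T2 -natrM.
    by rewrite [leRHS]exprS ler_peMl // exprn_ge0 // (le_trans ler01).
  rewrite -(ltr_nat R) natrM -w2; apply: (@le_lt_trans _ _ (64 * T * L)).
    by rewrite -mulrA ler_wpM2l // (le_trans KT) // ler_peMr.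
  have w1 : 1 <= w by rewrite -(@ler_pXn2r _ 2) ?nnegrE // w2 expr1n ler1n.
  by apply: lt_le_trans Tw _; rewrite expr2 ler_peMl.
have B0 : (0 < B)%N by nia.
have Bq : (B <= q)%N by nia.
have kB : (64 * k < B)%N by nia.
have [|e e0 /andP[xe ex]] := exists_pow2_between (4 * (k * B)); first by nia.
have [F _ cF] := pPrimePowerField (isT : prime 2) e0.
move: (2 ^ e)%N cF xe ex => r cF xe ex.
have r0 : (0 < r)%N by nia.
have rq : (r <= q)%N by nia.
(* After multiplication by [r], the terms [2 * k * B] and [4 * k * r] are each at most half of
   [r ^ 2]. *)
have kF : (2 * (k * (B %/ #|F| + 2)) <= #|F|)%N.
  rewrite cF -(leq_pmul2r r0); have := leq_trunc_div B r.
  have : (8 * k <= r)%N by nia.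
  move: (B %/ r)%N => t; nia.
pose X := (B * (B * #|F|) ^ k)%N; pose D := (trunc_log 2 X).+1.
have X0 : (0 < X)%N by rewrite muln_gt0 B0 expn_gt0 muln_gt0 B0 cF r0.
have [E HE] := slope_design F B k D k0 kF (trunc_log_ltn X (isT : 1 < 2)%N).
(* Since [B] and [r] are at most [q], [X <= q ^ (2 * k + 1)]; base 2 costs a factor 2, giving
   [6 * k * L], and the successor in [D] costs at most [k * L]. *)
have DL : D%:R <= 7 * k%:R * L.
  have kL : L <= k%:R * L by rewrite ler_peMl ?ler1n // (le_trans ler01).
  have XL : ln (X%:R : R) <= 3 * (k%:R * L).
    apply: (@le_trans _ _ (ln (q%:R ^+ (2 * k).+1))).
      rewrite ler_ln ?posrE ?exprn_gt0 ?ltr0n // -natrX ler_nat expnS expnM.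
      by rewrite leq_mul // leq_exp2r // expnS leq_mul // cF expn1.
    rewrite lnXn // -/L -[L *+ _]mulr_natl.
    by rewrite (_ : (2 * k).+1%:R = 2 * k%:R + 1) -?natr1 ?natrM //; lra.
  have : ln ((2 : R) ^+ trunc_log 2 X) <= ln (X%:R : R).
    by rewrite ler_ln ?posrE ?exprn_gt0 ?ltr0n // -natrX ler_nat trunc_logP.
  rewrite lnXn // -[_ *+ trunc_log _ _]mulr_natl => le1.
  have := ler_wpM2l (ler0n R (trunc_log 2 X)) (ln2_ge_half R).
  have -> : D%:R = (trunc_log 2 X)%:R + 1 :> R by rewrite natr1.
  by clear -kL XL le1 L1; lra.
have D0 : 0 <= D%:R :> R by [].
have [DrB Nle] : D%:R * r%:R <= B%:R :> R /\
    2 * B%:R + D%:R * r%:R * (q%:R * s%:R) <= 128 * T * w ^+ 3 * L.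
  apply: (@parameter_bounds R k%:R) => //; rewrite ?ler1n //.
  - by rewrite -natrM ler_nat.
  - by rewrite -natrM -natrD ler_nat ltnW.
  - by rewrite -natrX -!natrM ler_nat -mulnA (mulnA 4 4) in ex *; exact: ltnW.
have [loc loc_inj] := grid_injection n B B0.
have [|N BACN leN] := design_BAC n k B (n.-1 %/ B).+1 _ loc E loc_inj isT k0 _ HE.
  by rewrite card_prod card_ord cF -(ler_nat R) natrM.
exists N; split=> //.
have Rqs : ((n.-1 %/ B).+1 <= q * s)%N.
  rewrite ltn_divLR // -mulnA; apply: (@leq_trans n); first by rewrite prednK // expn_gt0 qn0.
  by rewrite /n -mulnn leq_mul2l qsB orbT.
have BR : (B * (n.-1 %/ B).+1 <= n + B)%N.
  by rewrite mulnS addnC leq_add2r mulnC (leq_trans (leq_trunc_div _ _)) // leq_pred.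
(* One [B] pays for rounding up the number of rows, the other for the bound of one extra symbol per
   parity bucket. *)
have {leN} : (N <= n + 2 * B + D * r * (q * s))%N.
  rewrite card_prod card_ord cF in leN; apply: leq_trans leN _.
  have : (D * r * (n.-1 %/ B).+1 <= D * r * (q * s))%N by rewrite leq_mul2l Rqs orbT.
  move=> h; apply: leq_trans (leq_add (leq_add BR h) (leqnn B)) _.
  by rewrite mul2n -addnn -!addnA !leq_add2l addnC.
rewrite -(ler_nat R) (natrD _ (n + _)) (natrD _ n) !natrM => leN; apply: le_trans leN _.
rewrite -addrA lerD2l; apply: le_trans Nle _; rewrite le_eqVlt; apply/orP; left; apply/eqP; ring.
Qed.
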